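(* Let $P$ be a UMEL-shellable poset. The $h$-polynomial of the order complex $\Delta(P)$ of $P$ only has real and nonpositive roots.
   Context: All posets are finite, bounded (minimum $\hat 0$, maximum $\hat 1$) and graded with rank function $\mathrm{rk}$, $\mathrm{rk}(\hat 0)=0$; the rank of $P$ is $\mathrm{rk}(\hat 1)$. Write $s\lessdot t$ if $t$ covers $s$, and $\mathcal E(P)$ for the set of covering pairs. UMEL-shellability. An edge labeling is a map $\lambda:\mathcal E(P)\to\Lambda$ to a totally ordered set $(\Lambda,\vartriangleleft)$. It is an EL-labeling if for all $s\le t$ there is a unique maximal chain $s=u_0\lessdot\cdots\lessdot u_k=t$ of $[s,t]$ with weakly increasing labels $\lambda(u_0,u_1)\trianglelefteq\cdots\trianglelefteq\lambda(u_{k-1},u_k)$, and its label sequence is lexicographically minimal among all maximal chains of $[s,t]$. An EL-labeled poset is a pair $(P,\lambda)$ with $\lambda$ an EL-labeling of $P$. For $s\in P$ let $\lambda_1\vartriangleleft\cdots\vartriangleleft\lambda_\ell$ be the distinct labels $\lambda(s,t)$, $t\gtrdot s$ (the labels above $s$). The width is $\omega_s(i)=|\{t: s\lessdot t,\ \lambda(s,t)=\lambda_i\}|$ (equal to $0$ for $i>\ell$). For $s\lessdot t$, $\mathrm{Ind}(s,t)$ is the $i$ with $\lambda(s,t)=\lambda_i$, and $\mathrm{des}_s(t)$ is the number of distinct labels above $t$ that are $\vartriangleleft\lambda(s,t)$. $(P,\lambda)$ is a rank-uniform labeled poset if (1) $\omega_s(i)=\omega_{s'}(i)$ for all $s,s'$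 of the same rank and all $i\ge1$; and (2) $\mathrm{des}_s(t)=\mathrm{des}_{s'}(t')$ whenever $s\lessdot t$, $s'\lessdot t'$, $\mathrm{rk}(s)=\mathrm{rk}(s')$ and $\mathrm{Ind}(s,t)=\mathrm{Ind}(s',t')$. In that case $\mathrm{des}_k(i)$ denotes $\mathrm{des}_s(t)$ for any $s$ of rank $k$ and $t\gtrdot s$ with $\mathrm{Ind}(s,t)=i$, and $\ell_k$ is the number of distinct labels above any element of rank $k$. It is monotonic if for every $0\le k\le \mathrm{rk}(P)-1$ the function $i\mapsto\mathrm{des}_k(i)$ is weakly increasing on $\{1,\dots,\ell_k\}$. $P$ is UMEL-shellable if it admits an EL-labeling $\lambda$ such that $(P,\lambda)$ is a monotonic rank-uniform labeled poset. $h$-polynomial. The order complex $\Delta(P)$ is the simplicial complex of all chains of $P$ (omitting $\hat 0,\hat 1$ does not change the $h$-polynomial). For a simplicial complex $\Delta$ of dimension $d-1$ with $f_i$ faces of cardinality $i$, $h(\Delta;y)=\sum_{i=0}^d h_iy^i$ where $\sum_{i=0}^d f_i(y-1)^{d-i}=\sum_{i=0}^d h_iy^{d-i}$; equivalently $h(\Delta;y)=\sum_{i=0}^d f_i\,y^i(1-y)^{d-i}$. *)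

(* Defs.v *)
From HB Require Import structures.
From mathcomp Require Import all_boot all_order all_algebra.
From mathcomp Require Import reals complex.

Set Implicit Arguments.
Unset Strict Implicit.
Unset Printing Implicit Defensive.

Import Order.TTheory GRing.Theory Num.Theory.

Section Posets.

Context {disp : Order.disp_t} {P : finTBPOrderType disp}.
Implicit Types (s t u : P) (p q : seq P) (rk : P -> nat).

Definition covers s t : bool :=
  (s < t)%O && [forall u, ~~ ((s < u)%O && (u < t)%O)].

(* A finite bounded poset is graded iff it has such a function, and the
   function is then unique. *)
Definition rank_function rk : Prop :=
  rk \bot%O = 0 /\ (forall s t, covers s t -> rk t = (rk s).+1).

(* The maximal chain s = u_0 < u_1 < ... < u_k = t of [s, t] is encoded, as
   usual with [path], by the sequence p = [:: u_1; ...; u_k]. *)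
Definition maximal_chain s t p : bool := path covers s p && (last s p == t).

Section Labelings.

(* An edge labeling is represented by a function on all pairs, of which only
   the values on covering pairs are ever used. *)
Context {dL : Order.disp_t} {L : orderType dL}.
Variable lam : P -> P -> L.

Definition chain_labels s p : seq L := pairmap lam s p.

Definition EL_labeling : Prop :=
  forall s t, (s <= t)%O ->
    exists p,
      [/\ maximal_chain s t p /\ sorted <=%O (chain_labels s p),
          (forall q, maximal_chain s t q -> sorted <=%O (chain_labels s q) ->
             q = p)
        & (forall q, maximal_chain s t q ->
             ((chain_labels s p : seqlexi L) <= chain_labels s q)%O)].

(* the increasing sequence lambda_1, ..., lambda_l of the labels above s *)
Definition labels_above s : seq L :=
  sort <=%O (undup [seq lam s t | t <- enum P & covers s t]).

(* labels are numbered from 1, whereas [index] counts from 0 *)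
Definition Ind s t : nat := (index (lam s t) (labels_above s)).+1.

Definition width s (i : nat) : nat :=
  #|[set t | covers s t && (Ind s t == i)]|.

Definition des s t : nat := count (fun a => (a < lam s t)%O) (labels_above t).

Definition rank_uniform rk : Prop :=
  (forall s s' (i : nat), rk s = rk s' -> 1 <= i -> width s i = width s' i) /\
  (forall s t s' t', covers s t -> covers s' t' -> rk s = rk s' ->
     Ind s t = Ind s' t' -> des s t = des s' t').

(* des_k(i) and l_k are read off an arbitrary edge, resp. element, of the
   right rank; by rank-uniformity the choice does not matter, see [des_rkE]
   and [num_labels_rkE]. *)
Definition des_rk rk (k i : nat) : nat :=
  if [pick e : P * P | [&& covers e.1 e.2, rk e.1 == k & Ind e.1 e.2 == i]]
    is Some e then des e.1 e.2 else 0.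

Definition num_labels_rk rk (k : nat) : nat :=
  if [pick s | rk s == k] is Some s then size (labels_above s) else 0.

Definition monotonic rk : Prop :=
  forall k i j : nat, k < rk \top%O ->
    1 <= i -> i <= j -> j <= num_labels_rk rk k ->
    des_rk rk k i <= des_rk rk k j.

Lemma mem_labels_above s a :
  reflect (exists2 t, covers s t & a = lam s t) (a \in labels_above s).
Proof.
rewrite mem_sort mem_undup; apply: (iffP mapP) => [[t]|[t st ->]].
  by rewrite mem_filter => /andP[st _] ->; exists t.
by exists t => //; rewrite mem_filter st mem_enum.
Qed.

Lemma width_gt0 s i : (0 < width s i) = (1 <= i <= size (labels_above s)).
Proof.
apply/idP/idP => [/card_gt0P[t]|/andP[i0 il]].
  rewrite inE => /andP[st /eqP <-]; rewrite /Ind /= index_mem.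
  by apply/mem_labels_above; exists t.
case: i i0 il => // i _ il.
have /(mem_nth (lam s s)) /mem_labels_above[t st e] := il.
have ul : uniq (labels_above s) by rewrite sort_uniq undup_uniq.
by apply/card_gt0P; exists t; rewrite inE st /Ind -e index_uniq /=.
Qed.

Lemma des_rkE rk s t :
  rank_uniform rk -> covers s t -> des_rk rk (rk s) (Ind s t) = des s t.
Proof.
move=> [_ rku] st; rewrite /des_rk; case: pickP => [[s' t'] /=|/(_ (s, t))].
  by case/and3P=> st' /eqP es /eqP ei; apply: rku.
by rewrite /= st !eqxx.
Qed.

Lemma num_labels_rkE rk s :
  rank_uniform rk -> num_labels_rk rk (rk s) = size (labels_above s).
Proof.
move=> [rku _]; rewrite /num_labels_rk; case: pickP => [s' /eqP es|/(_ s)].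
  have H i : 1 <= i -> (i <= size (labels_above s')) =
                      (i <= size (labels_above s)).
    by move=> i0; have := width_gt0 s' i; rewrite (rku _ s) // width_gt0 i0.
  apply/eqP; rewrite eqn_leq; apply/andP; split.
    by case E: (size (labels_above s')) => [//|m]; rewrite -H // E.
  by case E: (size (labels_above s)) => [//|m]; rewrite H // E.
by rewrite eqxx.
Qed.

End Labelings.

Definition UMEL_shellable rk : Prop :=
  exists (dL : Order.disp_t) (L : orderType dL) (lam : P -> P -> L),
    [/\ EL_labeling lam, rank_uniform lam rk & monotonic lam rk].

End Posets.

Local Open Scope ring_scope.

Section SimplicialComplexes.

(* A simplicial complex is given by the set of its faces, the empty face
   included; [csize Delta] is dim Delta + 1. *)
Context {T : finType}.
Variable Delta : {set {set T}}.

Definition csize : nat := (\max_(F in Delta) #|F|)%N.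

Definition fvec (i : nat) : nat := #|[set F in Delta | #|F| == i]|.

Definition h_poly : {poly int} :=
  \sum_(i < csize.+1) (fvec i)%:R *: ('X^i * (1 - 'X) ^+ (csize - i)).

End SimplicialComplexes.

Definition order_complex {disp : Order.disp_t} (P : finTBPOrderType disp) :
    {set {set P}} :=
  [set C : {set P} | [forall x in C, forall y in C, (x >=< y)%O]].

(* Main.v *)
Require Import Defs.
From mathcomp Require Import all_boot all_order all_algebra.
From mathcomp Require Import reals complex ring lra zify.

Set Implicit Arguments.
Unset Strict Implicit.
Unset Printing Implicit Defensive.

Import Order.TTheory GRing.Theory Num.Theory.

Local Open Scope ring_scope.

(** Let [y] be the variable of the h-polynomial. In an EL-labeled poset the
    h-polynomial of the order complex is the sum of [y ^ des] over the maximal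
    chains, where [des] counts the descents of the label sequence
    ([horner_h_poly_order_complex] and [chain_gfE]). To see this, write the
    weight of an ascent as [1 = y + (1 - y)] and that of a descent as [y]: each
    inner element of a maximal chain is then either marked, with weight [y], or
    unmarked with weight [1 - y], in which case it must be an ascent. Between
    two consecutive marked elements the labels increase weakly. As each interval
    has a unique maximal chain with this property, the marked elements determine
    the maximal chain, and they form an arbitrary chain without bottom and top.
    The sum over these chains is the h-polynomial.

    Let now [f k i] be the sum of [y ^ des] over the maximal chains of
    [[s, 1]] that start with a given edge of index [i] above an element [s] of
    rank [k]. Rank-uniformity says that it depends on [k] and [i] only, and that
      f k i = sum_(j <= des_k i) y * w j * f k.+1 j
              + sum_(j > des_k i) w j * f k.+1 j
    with [w j] the widths in rank [k.+1]. Monotonicity of [des_k] is what makes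
    such a recursion preserve interlacing families. Rather than interlacing,
    the proof follows the values at one complex number [z]. If [Im z > 0], the
    invariant is that the vectors
      f k 1, f k 2, ..., z * f k 1, z * f k 2, ...
    are nonzero and have weakly increasing arguments, the angle from
    [f k i] to [z * f k i] being [arg z]; the case [Im z < 0] is the mirror
    image. Multiplying by the widths does not affect the invariant for [k.+1],
    and each vector of rank [k] is then the sum of a window of consecutive
    vectors of the list for [k.+1]. Such a window lies in an angle smaller than
    [pi], so that its sum is not zero, and the sum turns forward as the window
    moves forward, which is the invariant for [k] ([turning_lift_sum],
    [lift_sum_neq0]). The h-polynomial at [z] is the sum of one more window, so
    it has no root off the real line ([desc_gf_from_neq0]). It has no positive
    root either, being a nonempty sum of powers of [y] ([desc_gf_from_gt0]). *)

(** * Families of complex numbers turning in one direction *)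

Section Turning.
Variables (R : rcfType) (z : complex R).
Implicit Types (v w : complex R) (f : nat -> complex R).

(** Up to the factor [Im z], the cross product of [v] and [w] as plane vectors.
    It is nonnegative when [w] is obtained from [v] by turning through at most
    [pi], in the direction in which multiplication by [z] turns. The factor
    [Im z] serves to treat both half-planes at once. *)
Definition turn v w : R :=
  complex.Im z * (complex.Re v * complex.Im w - complex.Im v * complex.Re w).

Lemma turnDl v1 v2 w : turn (v1 + v2) w = turn v1 w + turn v2 w.
Proof. by case: v1 v2 => [a b] [c d]; rewrite /turn /=; ring. Qed.

Lemma turnDr v w1 w2 : turn v (w1 + w2) = turn v w1 + turn v w2.
Proof. by case: w1 w2 => [a b] [c d]; rewrite /turn /=; ring. Qed.

Lemma turn0l w : turn 0 w = 0.
Proof. by rewrite /turn /=; ring. Qed.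

Lemma turn0r v : turn v 0 = 0.
Proof. by rewrite /turn /=; ring. Qed.

Lemma turnMn m n v w : turn (v *+ m) (w *+ n) = turn v w *+ (m * n).
Proof.
have l k v' : turn (v' *+ k) w = turn v' w *+ k.
  by elim: k => [|k IH]; rewrite ?mulr0n ?turn0l // !mulrS turnDl IH.
have r k v' : turn v' (w *+ k) = turn v' w *+ k.
  by elim: k => [|k IH]; rewrite ?mulr0n ?turn0r // !mulrS turnDr IH.
by rewrite r l mulrnA.
Qed.

Lemma turn_suml I r (Q : pred I) (F : I -> complex R) w :
  turn (\sum_(i <- r | Q i) F i) w = \sum_(i <- r | Q i) turn (F i) w.
Proof. exact: (big_morph (turn^~ w) (fun _ _ => turnDl _ _ _) (turn0l w)). Qed.

Lemma turn_sumr I r (Q : pred I) (F : I -> complex R) v :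
  turn v (\sum_(i <- r | Q i) F i) = \sum_(i <- r | Q i) turn v (F i).
Proof. exact: (big_morph (turn v) (turnDr v) (turn0r v)). Qed.

Lemma turn_vv v : turn v v = 0.
Proof. by rewrite /turn; ring. Qed.

Lemma turnZZ v w :
  turn (z * v) (z * w) = (complex.Re z ^+ 2 + complex.Im z ^+ 2) * turn v w.
Proof. by rewrite /turn; case: z v w => [a b] [c d] [e g] /=; ring. Qed.

Lemma turn_vZv v :
  turn v (z * v) = complex.Im z ^+ 2 * (complex.Re v ^+ 2 + complex.Im v ^+ 2).
Proof. by rewrite /turn; case: z v => [a b] [c d] /=; ring. Qed.

Lemma turn_vZv_ge0 v : 0 <= turn v (z * v).
Proof. by rewrite turn_vZv mulr_ge0 ?addr_ge0 ?sqr_ge0. Qed.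

Lemma turn_vZv_gt0 v : complex.Im z != 0 -> v != 0 -> 0 < turn v (z * v).
Proof.
move=> z0; rewrite eq_complex negb_and turn_vZv => v0.
rewrite mulr_gt0 ?exprn_even_gt0 //.
by case/orP: v0 => v0; [apply: ltr_wpDr|apply: ltr_wpDl];
  rewrite ?sqr_ge0 ?exprn_even_gt0.
Qed.

Lemma turnZZ_ge0 v w : 0 <= turn v w -> 0 <= turn (z * v) (z * w).
Proof. by move=> vw; rewrite turnZZ mulr_ge0 ?addr_ge0 ?sqr_ge0. Qed.

(** The arguments of [f 0, ..., f m.-1, z * f 0, ..., z * f m.-1] increase
    weakly, in the direction in which [z] turns. *)
Definition turning m f : Prop :=
  forall i j : nat, (i <= j < m)%N ->
    0 <= turn (f i) (f j) /\ 0 <= turn (f j) (z * f i).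

(** The sum of a window of [m] consecutive terms, starting with [f d], of the
    sequence [f 0, ..., f m.-1, z * f 0, ..., z * f m.-1]. *)
Definition lift_sum m f (d : nat) : complex R :=
  \sum_(j < m) (if (j < d)%N then z else 1) * f j.

(** Moving the start of the window from [d] to [e] replaces the block [B] of the
    terms of index in [[d, e[] by [z * B]. The common part is [z * A + C]. *)
Lemma lift_sum_split m f d e : (d <= e)%N ->
  exists A B C, [/\ lift_sum m f d = (z * A + C) + B,
    lift_sum m f e = (z * A + C) + z * B &
    turning m f -> [/\ 0 <= turn A B, 0 <= turn B C,
                       0 <= turn B (z * A) & 0 <= turn C (z * B)]].
Proof.
move=> de.
exists (\sum_(j < m | (j < d)%N) f j), (\sum_(j < m | (d <= j < e)%N) f j),
  (\sum_(j < m | (e <= j)%N) f j); split.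
- rewrite /lift_sum !mulr_sumr; rewrite [\sum_(_ < _ | (_ < d)%N) _]big_mkcond.
  rewrite [\sum_(_ < _ | (_ <= _ < _)%N) _]big_mkcond.
  rewrite [\sum_(_ < _ | (e <= _)%N) _]big_mkcond /=.
  rewrite -!big_split /=.
  apply: eq_bigr => j _; case: (ltnP j d) => [jd|dj] /=.
    by rewrite ltn_geF ?addr0 // (leq_trans jd).
  by rewrite leqNgt; case: (ltnP j e); rewrite /= ?(add0r, addr0) mul1r.
- rewrite /lift_sum !mulr_sumr; rewrite [\sum_(_ < _ | (_ < d)%N) _]big_mkcond.
  rewrite [\sum_(_ < _ | (_ <= _ < _)%N) _]big_mkcond.
  rewrite [\sum_(_ < _ | (e <= _)%N) _]big_mkcond /=.
  rewrite -!big_split /=.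
  apply: eq_bigr => j _; case: (ltnP j d) => [jd|dj] /=.
    by rewrite (leq_trans jd) // ltn_geF ?addr0 // (leq_trans jd).
  rewrite [(e <= j)%N]leqNgt.
  by case: (ltnP j e); rewrite /= ?(add0r, addr0) ?mul1r.
move=> tf; split.
- rewrite turn_suml sumr_ge0 // => i id.
  rewrite turn_sumr sumr_ge0 // => j /andP[dj je].
  by case: (tf i j) => //; rewrite ltn_ord andbT ltnW // (leq_trans id).
- rewrite turn_suml sumr_ge0 // => i /andP[_ ie].
  rewrite turn_sumr sumr_ge0 // => j je.
  by case: (tf i j) => //; rewrite ltn_ord andbT ltnW // (leq_trans ie).
- rewrite turn_suml sumr_ge0 // => i /andP[di _].
  rewrite mulr_sumr turn_sumr sumr_ge0 // => j jd.
  by case: (tf j i) => //; rewrite ltn_ord andbT ltnW // (leq_trans jd).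
- rewrite turn_suml sumr_ge0 // => i ei.
  rewrite mulr_sumr turn_sumr sumr_ge0 // => j /andP[_ je].
  by case: (tf j i) => //; rewrite ltn_ord andbT ltnW // (leq_trans je).
Qed.

(** With the notation of [lift_sum_split] and [D = z * A + C], the two windows
    are [D + B] and [D + z * B]. Both [turn B D] and [turn D (z * B)] are
    nonnegative, and so are [turn B (z * B)] and [turn D (z * D)]; the two
    inequalities to prove are sums of these, up to the factor [|z| ^ 2] by which
    multiplication by [z] scales [turn]. The term [turn D (z * D)] is kept whole
    because its summand [turn C (z * (z * A))] has no definite sign. *)
Lemma turning_lift_sum m l f (d : nat -> nat) :
  {in gtn l &, {homo d : i j / (i <= j)%N}} ->
  turning m f -> turning l (lift_sum m f \o d).
Proof.
move=> dM tf i j /andP[ij jl] /=.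
have {}dM : (d i <= d j)%N by apply: dM => //; apply: leq_ltn_trans jl.
have [A [B [C [-> -> /(_ tf)[AB BC BA CB]]]]] := lift_sum_split m f dM.
set D := z * A + C.
have BD : 0 <= turn B D by rewrite turnDr addr_ge0.
have DzB : 0 <= turn D (z * B) by rewrite turnDl addr_ge0 ?turnZZ_ge0.
have zBzD : 0 <= turn (z * B) (z * D) by apply: turnZZ_ge0.
have [DzD BzB] := (turn_vZv_ge0 D, turn_vZv_ge0 B).
have [DD zBzB] := (turn_vv D, turn_vv (z * B)).
clearbody D.
by split; rewrite ?mulrDr !(turnDl, turnDr); lra.
Qed.

(** The window that starts with [f d] lies on one side of the line spanned by
    [z * f d], and its first vector is strictly on that side. This is for
    [d < m]; the windows for [d >= m] are [z] times the one that starts at 0. *)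
Lemma lift_sum_neq0 m f d :
  complex.Im z != 0 -> (0 < m)%N -> (forall i : nat, (i < m)%N -> f i != 0) ->
  turning m f -> lift_sum m f d != 0.
Proof.
move=> z0 m0 f0 tf; wlog dm : d / (d < m)%N => [IH|].
  have [/IH//|md] := ltnP d m.
  suff -> : lift_sum m f d = z * lift_sum m f 0.
    by rewrite mulf_neq0 ?IH //; apply: contraNneq z0 => ->.
  rewrite mulr_sumr; apply: eq_bigr => j _.
  by rewrite (leq_trans (ltn_ord j) md) ltn0 mul1r.
apply/eqP => e.
have := turn0l (z * f d); rewrite -{}e turn_suml (bigD1 (Ordinal dm)) //=.
rewrite ltnn mul1r => /eqP.
rewrite gt_eqF // ltr_wpDr ?turn_vZv_gt0 ?f0 // sumr_ge0 // => j _.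
have [jd|dj] := ltnP j d.
  by apply: turnZZ_ge0; case: (tf j d) => //; rewrite ltnW.
by rewrite mul1r; case: (tf d j) => //; rewrite dj /=.
Qed.

End Turning.

(** * Ranks and covers *)

Section Graded.
Context {disp : Order.disp_t} {P : finTBPOrderType disp}.
Context {dL : Order.disp_t} {L : orderType dL}.
Variables (rk : P -> nat) (lam : P -> P -> L).
Hypothesis rkP : rank_function rk.
Hypothesis lamP : EL_labeling lam.
Implicit Types (s t u c : P) (p : seq P) (a : L).

Lemma rk_path s p : path covers s p -> rk (last s p) = (rk s + size p)%N.
Proof.
elim: p s => [|t p IH] s /=; first by rewrite addn0.
by case/andP=> /(proj2 rkP) st /IH ->; rewrite st addSnnS.
Qed.

Lemma path_covers_le s p : path covers s p -> (s <= last s p)%O.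
Proof.
elim: p s => //= t p IH s /andP[/andP[/ltW st _] /IH].
exact: le_trans.
Qed.

Lemma exists_maximal_chain s t : (s <= t)%O -> exists p, maximal_chain s t p.
Proof. by move=> /lamP[p [[sp _] _ _]]; exists p. Qed.

Lemma rk_lt s t : (s < t)%O -> (rk s < rk t)%N.
Proof.
move=> st; have /exists_maximal_chain[p /andP[sp /eqP e]] := ltW st.
rewrite -e rk_path //; case: p e {sp} => [e|c p _]; last by rewrite /=; lia.
by rewrite -e /= ltxx in st.
Qed.

Lemma rk_le_top s : (rk s <= rk \top%O)%N.
Proof. by have := lex1 s; rewrite le_eqVlt => /predU1P[->|/rk_lt/ltnW]. Qed.

Lemma rk_lt_top s : s != \top%O -> (rk s < rk \top%O)%N.
Proof. by rewrite -ltx1; apply: rk_lt. Qed.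

Lemma exists_cover s : s != \top%O -> exists t, covers s t.
Proof.
move=> s1; have [[|t p] /andP[/= sp /eqP e]] := exists_maximal_chain (lex1 s).
  by rewrite -e eqxx in s1.
by exists t; case/andP: sp.
Qed.

(** * Maximal chains counted by descents *)

Section GeneratingFunction.
Variables (A : comNzRingType) (y : A).

(** The sum of [y ^ des] over the maximal chains of [[t, 1]], where [des] also
    counts a descent at [t] if the first label is smaller than [a], the label of
    an edge entering [t]. The recursion is on the number [n] of edges left. *)
Fixpoint desc_gf_rec n t a : A :=
  if n is n'.+1 then
    \sum_(u | covers t u)
      (if (lam t u < a)%O then y else 1) * desc_gf_rec n' u (lam t u)
  else 1.

Definition desc_gf t a := desc_gf_rec (rk \top%O - rk t) t a.

Definition desc_gf_from s := \sum_(t | covers s t) desc_gf t (lam s t).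

Lemma desc_gf_top a : desc_gf \top%O a = 1.
Proof. by rewrite /desc_gf subnn. Qed.

Lemma desc_gfE t a : t != \top%O ->
  desc_gf t a = \sum_(u | covers t u)
    (if (lam t u < a)%O then y else 1) * desc_gf u (lam t u).
Proof.
move=> /rk_lt_top t1; rewrite /desc_gf.
case E: (rk _ - rk t)%N => [|n]; first by lia.
apply: eq_bigr => u /(proj2 rkP) tu.
by have -> : n = (rk \top%O - rk u)%N by lia.
Qed.

(** The number of weakly increasing maximal chains of [[t, c]] with [m] edges
    whose first label satisfies [r]. *)
Fixpoint num_rising m (r : pred L) t c : nat :=
  if m is m'.+1 then
    (\sum_(u | covers t u && r (lam t u))
      num_rising m' (fun b => lam t u <= b)%O u c)%N
  else t == c.

Definition rising (r : pred L) t c p :=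
  maximal_chain t c p && (sorted <=%O (chain_labels lam t p) &&
  (if chain_labels lam t p is b :: _ then r b else true)).

Lemma rising_cons r t c u p :
  rising r t c (u :: p) = (covers t u && r (lam t u)) &&
    rising (fun b => lam t u <= b)%O u c p.
Proof.
rewrite /rising /maximal_chain /=.
case: p => [|v p] /=; case: (covers t u) => //=; case: (r _) => //=;
  rewrite ?andbF ?andbT //=; congr (_ && _); exact: andbC.
Qed.

Lemma num_rising_none m r t c :
  (forall p, size p = m -> ~~ rising r t c p) -> num_rising m r t c = 0%N.
Proof.
elim: m r t => [|m IH] r t /= no.
  by have := no [::] erefl; rewrite /rising /maximal_chain /= andbT; case: eqP.
rewrite big1 // => u tu; apply: IH => p sp.
by have := no (u :: p); rewrite rising_cons tu /= sp; apply.
Qed.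

Lemma num_rising_unique m r t c p :
  size p = m -> rising r t c p ->
  (forall q, size q = m -> rising r t c q -> q = p) -> num_rising m r t c = 1%N.
Proof.
elim: m r t p => [|m IH] r t [|v p] //= sp.
  by rewrite /rising /maximal_chain /= andbT => ->.
case: sp => sp; rewrite rising_cons => /andP[tv pv] uniq_p.
rewrite (bigD1 v) //= (IH _ _ p) //; last first.
  move=> q sq qv; suff [//] : v :: q = v :: p.
  by apply: uniq_p; rewrite /= ?sq // rising_cons tv.
rewrite big1 // => u /andP[tu uv]; apply: num_rising_none => q sq.
apply: contraNN uv => qu; suff [->] : u :: q = v :: p by [].
by apply: uniq_p; rewrite /= ?sq // rising_cons tu.
Qed.

Lemma num_rising_EL s c :
  (s <= c)%O -> num_rising (rk c - rk s) predT s c = 1%N.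
Proof.
move=> /lamP[p [[sp p_sorted] uniq_p _]].
have sizeP q : maximal_chain s c q -> (rk c - rk s)%N = size q.
  by case/andP=> /rk_path + /eqP e; rewrite e => ->; lia.
apply: (@num_rising_unique _ _ _ _ p).
- by rewrite -(sizeP p).
- by rewrite /rising sp p_sorted /=; case: (chain_labels _ _ _).
- by move=> q _ /and3P[sq q_sorted _]; apply: uniq_p.
Qed.

Lemma num_rising_rk_le r t c : (rk c <= rk t)%N -> t != c ->
  num_rising (rk c - rk t) r t c = 0%N.
Proof. by rewrite -subn_eq0 => /eqP -> /negPf /= ->. Qed.

(** The weight of [c] as the next marked element, times that of all that follows:
    the top element closes the chain and has no weight of its own. *)
Definition tail_gf c := if c == \top%O then 1 else y * desc_gf_from c.

(** Grouping the maximal chains by their first marked element [c]: at [t], the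
    weight is [y] if [t] is marked, that is [c = t], and [1 - y] if it is not,
    which is allowed only if the next label is at least [a]. *)
Lemma desc_gf_rising t a :
  desc_gf t a = \sum_c
    (num_rising (rk c - rk t) (fun b => a <= b)%O t c)%:R *
       ((1 - y) ^+ (rk c - rk t) * tail_gf c).
Proof.
have [n le_n] := ubnP (rk \top%O - rk t); elim: n t a le_n => // n IH t a le_n.
rewrite (bigD1 t) //= subnn /= eqxx !mul1r {1}/tail_gf.
have [->|t1] := eqVneq t \top%O.
  rewrite desc_gf_top big1 ?addr0 // => c c1.
  by rewrite num_rising_rk_le ?mul0r ?rk_le_top // eq_sym.
rewrite desc_gfE //= /desc_gf_from mulr_sumr.
(* the terms with [c != t] are those of the chains on which [t] is unmarked *)
have -> : \sum_(c | c != t)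
    (num_rising (rk c - rk t) (fun b => a <= b)%O t c)%:R *
       ((1 - y) ^+ (rk c - rk t) * tail_gf c) =
  \sum_(u | covers t u && (a <= lam t u)%O) (1 - y) * desc_gf u (lam t u).
  transitivity (\sum_(c | c != t) \sum_(u | covers t u && (a <= lam t u)%O)
     (1 - y) * ((num_rising (rk c - rk u) (fun b => lam t u <= b)%O u c)%:R *
       ((1 - y) ^+ (rk c - rk u) * tail_gf c))).
    apply: eq_bigr => c ct; have [ct'|tc] := leqP (rk c) (rk t).
      rewrite num_rising_rk_le ?mul0r 1?eq_sym // big1 // => u /andP[tu _].
      have {}tu := proj2 rkP _ _ tu.
      rewrite num_rising_rk_le ?mul0r ?mulr0 //; first by lia.
      by apply/eqP => uc; move: ct'; rewrite -uc; lia.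
    case E: (rk c - rk t)%N => [|m] /=; first by lia.
    rewrite natr_sum mulr_suml; apply: eq_bigr => u /andP[/(proj2 rkP) tu _].
    have <- : (rk c - rk u)%N = m by lia.
    by rewrite exprS; ring.
  rewrite exchange_big; apply: eq_bigr => u /andP[tu _] /=.
  rewrite -mulr_sumr IH; last first.
    have := proj2 rkP _ _ tu; have := rk_le_top u; lia.
  congr (_ * _); rewrite [RHS](bigD1 t) //=.
  have rtu := proj2 rkP _ _ tu.
  rewrite num_rising_rk_le ?mul0r ?add0r //; first by lia.
  by apply: contraTneq tu => ->; rewrite /covers ltxx.
rewrite [X in _ = _ + X]big_mkcondr -big_split /=; apply: eq_bigr => u tu.
(* an ascent weighs [y + (1 - y) = 1], a descent [y] *)
by rewrite ltNge; case: (a <= _)%O => /=; ring.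
Qed.

(** The increasing chain from [s] to the next marked element [c] is unique in an
    EL-labeling, and passes through [(rk c - rk s).-1] unmarked elements. *)
Lemma desc_gf_fromE s :
  desc_gf_from s = \sum_(c | (s < c)%O) (1 - y) ^+ (rk c - rk s).-1 * tail_gf c.
Proof.
rewrite /desc_gf_from.
under eq_bigr => t st do rewrite desc_gf_rising.
rewrite exchange_big [RHS]big_mkcond /=; apply: eq_bigr => c _.
case: ifP => [sc|/negbT sc].
  have := num_rising_EL (ltW sc); have := rk_lt sc.
  case E: (rk c - rk s)%N => [|m] /= lt_rk; first by lia.
  move=> e; rewrite -[RHS]mul1r -[X in X * _](_ : 1%:R = 1) // -e natr_sum.
  rewrite mulr_suml; under [RHS]eq_bigl => u do rewrite andbT.
  apply: eq_bigr => u /(proj2 rkP) su.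
  by have -> : (rk c - rk u)%N = m by lia.
rewrite big1 // => t st; rewrite num_rising_none ?mul0r // => p sp.
apply: contraNN sc => /andP[/andP[tp /eqP <-] _].
by apply: lt_le_trans (path_covers_le tp); case/andP: st.
Qed.

End GeneratingFunction.

(** * Chains of the order complex *)

Section OrderComplex.
Variables (A : comNzRingType) (y : A).
Implicit Types C D : {set P}.

Definition chain_above s C : bool :=
  (C \in order_complex P) && [forall x in C, (s < x)%O].

Lemma order_complexP C :
  reflect {in C &, forall x z, (x >=< z)%O} (C \in order_complex P).
Proof.
rewrite inE; apply: (iffP forall_inP) => H x.
  by move=> z /H/forall_inP; apply.
by move=> xC; apply/forall_inP => z; apply: H.
Qed.

Lemma chain_aboveU1 c C : chain_above c C ->
  [/\ c |: C \in order_complex P, {in c |: C, forall x, (c <= x)%O}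
    & c \notin C].
Proof.
case/andP=> /order_complexP Cch /forall_inP cC.
have le x : x \in c |: C -> (c <= x)%O.
  by case/setU1P=> [->//|/cC/ltW].
split=> //; last by apply/negP => /cC; rewrite ltxx.
apply/order_complexP => x z /setU1P[->|xC] /setU1P[->|zC].
- exact: comparablexx.
- by apply/le_comparable/ltW/cC.
- by apply/ge_comparable/ltW/cC.
- exact: Cch.
Qed.

Lemma chain_aboveD1 c C :
  C \in order_complex P -> {in C, forall x, (c <= x)%O} ->
  chain_above c (C :\ c).
Proof.
move=> /order_complexP Cch cC; apply/andP; split.
  by apply/order_complexP => x z /setD1P[_ xC] /setD1P[_ zC]; apply: Cch.
by apply/forall_inP => x /setD1P[xc xC]; rewrite lt_neqAle eq_sym xc cC.
Qed.

Lemma chain_min C : C \in order_complex P -> C != set0 ->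
  exists2 c, c \in C & {in C, forall x, (c <= x)%O}.
Proof.
move=> /order_complexP Cch /set0Pn[x0 x0C].
case: (arg_minnP rk x0C) => c cC cmin; exists c => // x xC.
have /orP[//|] := Cch _ _ cC xC; rewrite le_eqVlt => /predU1P[->//|/rk_lt].
by rewrite ltnNge cmin.
Qed.

Lemma card_chain_above s C : chain_above s C -> (#|C| <= rk \top%O - rk s)%N.
Proof.
have [n] := ubnP #|C|; elim: n s C => // n IH s C le_n sC.
have [->|C0] := eqVneq C set0; first by rewrite cards0.
have /andP[Cch /forall_inP Cs] := sC.
have [c cC cmin] := chain_min Cch C0.
have := IH c _ _ (chain_aboveD1 Cch cmin); have := Cs c cC => /rk_lt.
have := rk_le_top c; move: le_n; rewrite (cardsD1 c C) cC.
set k := #|_|; set q := rk \top%O; clearbody k q => le_n rk_c lt_sc IHc.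
have {}IHc : (k <= q - rk c)%N by apply: IHc; lia.
by lia.
Qed.

(** A chain with least element [c] is [c] together with a chain above [c]. *)
Lemma sum_chains_min (F : {set P} -> A) c :
  \sum_(C in order_complex P | (c \in C) && [forall x in C, (c <= x)%O]) F C =
  \sum_(C | chain_above c C) F (c |: C).
Proof.
rewrite (reindex_onto (fun C => c |: C) (fun C => C :\ c)) /=; last first.
  by move=> C /and3P[_ cC _]; rewrite setD1K.
apply: eq_bigl => C; apply/idP/idP.
  case/andP=> /and3P[Cch _ /forall_inP cmin] /eqP <-.
  exact: chain_aboveD1.
case/chain_aboveU1=> Cch cmin cC.
by rewrite Cch setU11 setU1K // eqxx andbT; apply/forall_inP.
Qed.

(** The h-polynomial of the chains that consist of elements larger than [s], the
    top element allowed. *)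
Definition chain_gf s :=
  \sum_(C | chain_above s C) y ^+ #|C| * (1 - y) ^+ (rk \top%O - rk s - #|C|).

Lemma chain_gf_top : chain_gf \top%O = 1.
Proof.
rewrite /chain_gf (bigD1 set0) /=; last first.
  apply/andP; split; first by apply/order_complexP => x z; rewrite inE.
  by apply/forall_inP => x; rewrite inE.
rewrite cards0 subnn !expr0 mulr1 big1 ?addr0 //.
move=> C /andP[/andP[_ /forall_inP Ct]].
by case/set0Pn=> x /Ct; rewrite lt1x.
Qed.

Lemma chain_gf_rec s :
  chain_gf s = (1 - y) ^+ (rk \top%O - rk s) +
    \sum_(c | (s < c)%O) (1 - y) ^+ (rk c - rk s).-1 * (y * chain_gf c).
Proof.
rewrite /chain_gf (bigD1 set0) /=; last first.
  apply/andP; split; first by apply/order_complexP => x z; rewrite inE.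
  by apply/forall_inP => x; rewrite inE.
rewrite cards0 subn0 expr0 mul1r; congr (_ + _).
pose low C := odflt s [pick c in C | [forall x in C, (c <= x)%O]].
have lowP C : C \in order_complex P -> C != set0 ->
    low C \in C /\ {in C, forall x, (low C <= x)%O}.
  move=> Cch C0; rewrite /low; case: pickP => [c /andP[cC /forall_inP//]|no].
  have [c cC cmin] := chain_min Cch C0; have := no c; rewrite cC /=.
  by move/forall_inP; case.
rewrite (partition_big low (fun c => (s < c)%O)) /=; last first.
  by move=> C /andP[/andP[Cch /forall_inP Cs] C0]; apply: Cs; case: (lowP C).
apply: eq_bigr => c sc.
rewrite (eq_bigl (fun C => (C \in order_complex P) &&
    ((c \in C) && [forall x in C, (c <= x)%O]))); last first.
  move=> C; apply/idP/idP.
    case/andP=> /andP[/andP[Cch _] C0] /eqP <-; have [lC lmin] := lowP C Cch C0.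
    by rewrite Cch lC; apply/forall_inP.
  case/and3P=> Cch cC /forall_inP cmin.
  have C0 : C != set0 by apply/set0Pn; exists c.
  have [lC lmin] := lowP C Cch C0.
  rewrite C0 /chain_above Cch /= eq_le lmin // cmin // !andbT.
  by apply/forall_inP => x /cmin; apply: lt_le_trans.
rewrite sum_chains_min !mulr_sumr; apply: eq_bigr => C cC.
have [_ _ c_notin] := chain_aboveU1 cC; have leC := card_chain_above cC.
have lt_sc := rk_lt sc.
rewrite cardsU1 c_notin /= add1n exprS.
have -> : (rk \top%O - rk s - #|C|.+1 =
           (rk c - rk s).-1 + (rk \top%O - rk c - #|C|))%N.
  by have := rk_le_top c; lia.
by rewrite exprD; ring.
Qed.

(** Both sides satisfy the same recursion: [chain_gf_rec] splits a chain at its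
    least element, [desc_gf_fromE] a marked chain at its first element. The
    chain that is empty and the one reduced to the top element together weigh
    [(1 - y) ^+ n + y * (1 - y) ^+ n.-1 = (1 - y) ^+ n.-1]. *)
Lemma chain_gfE s : s != \top%O -> chain_gf s = desc_gf_from y s.
Proof.
have [n le_n] := ubnP (rk \top%O - rk s); elim: n s le_n => // n IH s le_n s1.
have lt1 := rk_lt_top s1.
rewrite desc_gf_fromE chain_gf_rec.
rewrite (bigD1 \top%O) ?ltx1 //= [RHS](bigD1 \top%O) ?ltx1 //= /tail_gf eqxx.
rewrite chain_gf_top addrA !mulr1; congr (_ + _).
  case E: (rk _ - rk s)%N => [|m] /=; first by lia.
  by rewrite exprS; ring.
apply: eq_bigr => c /andP[/rk_lt sc c1]; rewrite (negPf c1) IH //.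
have := rk_lt_top c1; lia.
Qed.

Lemma csize_order_complex : csize (order_complex P) = (rk \top%O).+1.
Proof.
apply/eqP; rewrite eqn_leq; apply/andP; split.
  apply/bigmax_leqP => C Cch.
  have : chain_above \bot%O (C :\ \bot%O).
    by apply: chain_aboveD1 => // x _; apply: le0x.
  move/card_chain_above; rewrite (proj1 rkP) subn0 (cardsD1 \bot%O C).
  by rewrite -add1n; apply: leq_add; apply: leq_b1.
have [p /andP[cp /eqP ep]] := exists_maximal_chain (le0x (\top%O : P)).
have := rk_path cp; rewrite ep (proj1 rkP) add0n => ->.
have sp : sorted <%O (\bot%O :: p : seq P).
  by apply: sub_path cp => x z /andP[].
rewrite -[X in (X <= _)%N](_ : #|[set x in \bot%O :: p]| = _); last first.
  by rewrite cardsE (card_uniqP _) // lt_sorted_uniq.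
apply: (@leq_bigmax_cond _ _ (fun C : {set P} => #|C|)).
apply/order_complexP => x z; rewrite !inE -!in_cons => xp zp.
have /allrelP : all2rel >=<%O (\bot%O :: p : seq P).
  rewrite -pairwise_all2rel; first last.
  - by move=> u v; rewrite comparable_sym.
  - exact: comparablexx.
  rewrite lt_sorted_pairwise in sp; apply: sub_pairwise sp => u v.
  exact: lt_comparable.
by apply.
Qed.

(** A chain may or may not contain the bottom element: its contribution to the
    h-polynomial is [y + (1 - y) = 1]. *)
Lemma horner_h_poly_order_complex :
  (map_poly intr (h_poly (order_complex P))).[y] = chain_gf \bot%O.
Proof.
have -> : (map_poly intr (h_poly (order_complex P))).[y] =
    \sum_(C in order_complex P) y ^+ #|C| * (1 - y) ^+ ((rk \top%O).+1 - #|C|).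
  rewrite /h_poly csize_order_complex rmorph_sum horner_sum.
  rewrite (partition_big (fun C => inord #|C| : 'I_(rk \top%O).+2) predT) //=.
  apply: eq_bigr => i _.
  rewrite map_polyZ rmorphM !rmorphXn rmorphB /= map_polyX rmorph1 !hornerE.
  rewrite /= rmorph_nat /fvec -sum1_card -mulrA natr_sum mulr_suml.
  have card_le C : C \in order_complex P -> (#|C| < (rk \top%O).+2)%N.
    by move=> Cch; rewrite ltnS -csize_order_complex; apply: leq_bigmax_cond.
  apply: eq_big => C; rewrite inE.
    by apply: andb_id2l => /card_le cC; rewrite -val_eqE /= inordK.
  by case/andP=> _ /eqP <-; rewrite mul1r.
have bot_min C : [forall x in C, (\bot%O <= x)%O].
  by apply/forall_inP => x _; apply: le0x.
have above_bot C :
    chain_above \bot%O C = (C \in order_complex P) && (\bot%O \notin C).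
  apply: andb_id2l => _; apply/forall_inP/idP => [C0|C0 x xC].
    by apply/negP => /C0; rewrite ltxx.
  by rewrite lt0x; apply: contraNneq C0 => <-.
rewrite (bigID (fun C => (\bot%O \in C) &&
                         [forall x in C, (\bot%O <= x)%O])) /=.
rewrite sum_chains_min.
have -> : chain_gf \bot%O = y * chain_gf \bot%O + (1 - y) * chain_gf \bot%O.
  by ring.
rewrite /chain_gf !mulr_sumr; congr (_ + _); last first.
  apply: eq_big => C; first by rewrite bot_min andbT above_bot.
  rewrite bot_min andbT -above_bot => /card_chain_above.
  by rewrite (proj1 rkP) subn0 => le_C; rewrite subSn // exprS; ring.
apply: eq_bigr => C cC; have [_ _ c_notin] := chain_aboveU1 cC.
by rewrite cardsU1 c_notin add1n (proj1 rkP) subn0 subSS exprS; ring.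
Qed.

End OrderComplex.

(** * Absence of positive roots *)

Lemma desc_gf_from_gt0 (B : numDomainType) (y : B) s :
  0 < y -> s != \top%O -> 0 < desc_gf_from y s.
Proof.
move=> y0.
have sum_gt0 t (F : P -> B) : t != \top%O ->
    (forall u, covers t u -> 0 < F u) -> 0 < \sum_(u | covers t u) F u.
  move=> /exists_cover[v tv] F0; rewrite (bigD1 v) //= ltr_pwDl ?F0 //.
  by apply: sumr_ge0 => u /andP[/F0/ltW].
suff gf0 t a : 0 < desc_gf y t a by move=> s1; apply: sum_gt0.
have [n le_n] := ubnP (rk \top%O - rk t); elim: n t a le_n => // n IH t a le_n.
have [->|t1] := eqVneq t \top%O; first by rewrite desc_gf_top.
rewrite desc_gfE //; apply: sum_gt0 => // u tu; apply: mulr_gt0.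
  by case: ifP.
by apply: IH; have := proj2 rkP _ _ tu; have := rk_lt_top t1; lia.
Qed.

(** * Labels and widths above an element *)

Lemma index_label_lt s t : covers s t ->
  (index (lam s t) (labels_above lam s) < size (labels_above lam s))%N.
Proof. by move=> st; rewrite index_mem; apply/mem_labels_above; exists t. Qed.

(** The labels above [s] that are smaller than [a] are the first ones; hence
    descents at [s] are read off the index of the outgoing edge. *)
Lemma lt_label s t a : covers s t ->
  (lam s t < a)%O = (index (lam s t) (labels_above lam s) <
                     count (fun b => b < a)%O (labels_above lam s))%N.
Proof.
move=> st; have in_lab : lam s t \in labels_above lam s.
  by apply/mem_labels_above; exists t.
have lab_lt : sorted <%O (labels_above lam s).
  by rewrite sort_lt_sorted undup_uniq.
have lab_le : sorted <=%O (labels_above lam s).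
  by move: lab_lt; rewrite lt_sorted_uniq_le => /andP[].
apply/idP/idP => [lt_a|/(nth_count_lt (lam s t) lab_le)]; last first.
  by rewrite nth_index.
rewrite -[X in (X < _)%N](count_lt_nth (lam s t) lab_lt) ?index_mem //.
rewrite nth_index //; set ls := labels_above lam s.
have := count_lt_le_mem (lam s t) ls; rewrite in_lab => /leq_trans; apply.
by apply: sub_count => b /= /le_lt_trans; apply.
Qed.

Lemma sum_covers_Ind (V : nmodType) s (F : nat -> V) :
  \sum_(t | covers s t) F (Ind lam s t) =
  \sum_(i < size (labels_above lam s)) F i.+1 *+ width lam s i.+1.
Proof.
transitivity (\sum_(i < size (labels_above lam s))
   \sum_(t | covers s t && (Ind lam s t == i.+1)) F (Ind lam s t)).
  rewrite (exchange_big_dep (covers s)) /=; last by move=> ? ? _ /andP[].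
  apply: eq_bigr => t st.
  rewrite (bigD1 (Ordinal (index_label_lt st))) /=; last by rewrite st eqxx.
  rewrite big1 ?addr0 // => i /andP[/andP[_ /eqP it]]; case/negP.
  by apply/eqP/val_inj => /=; case: it.
apply: eq_bigr => i _; rewrite -sumr_const.
by apply: eq_big => [t|t /andP[_ /eqP -> //]]; rewrite inE.
Qed.

(** * Absence of nonreal roots *)

Section Uniform.
Hypotheses (uni : rank_uniform lam rk) (mono : monotonic lam rk).
Variables (R : rcfType) (z : complex R).
Hypothesis Imz : complex.Im z != 0.

Lemma turning_width m (t : P) (f : nat -> complex R) :
  turning z m f -> turning z m (fun j => f j *+ width lam t j.+1).
Proof.
move=> tf i j /tf[h1 h2]; rewrite mulrnAr !turnMn.
by split; apply: mulrn_wge0.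
Qed.

Lemma width_neq0 (t : P) (f : nat -> complex R) (j : nat) :
  (j < size (labels_above lam t))%N -> f j != 0 -> f j *+ width lam t j.+1 != 0.
Proof.
by move=> jl f0; rewrite mulrn_eq0 negb_or f0 andbT -lt0n width_gt0.
Qed.

Lemma size_labels_gt0 t : t != \top%O -> (0 < size (labels_above lam t))%N.
Proof.
by move=> /exists_cover[u tu]; apply: leq_ltn_trans (index_label_lt tu).
Qed.

(** Downward induction on the rank [k]. By [des_rkE] and the uniformity of the
    widths, the vectors of rank [k] are windows of those of rank [k.+1], whose
    starting points increase because the labeling is monotonic. *)
Lemma turning_desc_gf k : (k < rk \top%O)%N ->
  exists f : nat -> complex R,
  [/\ forall s t, covers s t -> rk s = k ->
        desc_gf z t (lam s t) = f (Ind lam s t).-1,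
      forall i : nat, (i < num_labels_rk lam rk k)%N -> f i != 0
    & turning z (num_labels_rk lam rk k) f].
Proof.
have turn1 m : turning z m (fun=> 1).
  by move=> i j _; rewrite turn_vv turn_vZv_ge0.
have [n] := ubnP (rk \top%O - k); elim: n k => // n IH k le_n kn.
(* edges into the top element *)
have [k1|] := leqP (rk \top%O) k.+1.
  exists (fun=> 1); split=> // [s t st sk|i _]; last exact: oner_neq0.
  have [->|/rk_lt_top] := eqVneq t \top%O; first exact: desc_gf_top.
  by rewrite (proj2 rkP _ _ st) sk ltnNge k1.
(* the widths are read off some element [t0] of rank [k.+1]; if there is none,
   then no edge starts in rank [k] *)
move=> k1; have [t0 /eqP t0k|no] := pickP (fun t => rk t == k.+1); last first.
  exists (fun=> 1); split=> // [s t st sk|i _]; last exact: oner_neq0.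
  by have := no t; rewrite (proj2 rkP _ _ st) sk eqxx.
have [|//|g [gE g0 gT]] := IH k.+1; first by lia.
have sz t : rk t = k.+1 ->
    size (labels_above lam t) = num_labels_rk lam rk k.+1.
  by move=> <-; rewrite (num_labels_rkE t uni).
pose g' j := g j *+ width lam t0 j.+1.
exists (fun i =>
  lift_sum z (num_labels_rk lam rk k.+1) g' (des_rk lam rk k i.+1)).
split.
- move=> s t st sk; have tk : rk t = k.+1 by rewrite (proj2 rkP _ _ st) sk.
  have t1 : t != \top%O by apply: contraTneq k1 => <-; rewrite tk ltnn.
  rewrite desc_gfE //.
  transitivity (\sum_(u | covers t u)
     (if ((Ind lam t u).-1 < des lam s t)%N then z else 1) *
       g (Ind lam t u).-1).
    by apply: eq_bigr => u tu; rewrite lt_label // (gE _ _ tu tk).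
  rewrite (sum_covers_Ind t
    (fun i => (if (i.-1 < des lam s t)%N then z else 1) * g i.-1)) sz //.
  rewrite -(des_rkE uni st) sk; apply: eq_bigr => j _ /=.
  by rewrite /g' mulrnAr (proj1 uni t t0) // tk.
- move=> i _; apply: lift_sum_neq0 => //; last exact: turning_width.
    rewrite -(sz t0) // size_labels_gt0 //.
    by apply: contraTneq k1 => <-; rewrite t0k ltnn.
  by move=> j jl; apply: width_neq0; rewrite ?sz ?g0.
- apply: turning_lift_sum; last exact: turning_width.
  by move=> i j _ jl ij; apply: mono.
Qed.

Lemma desc_gf_from_neq0 : \bot%O != \top%O :> P -> desc_gf_from z \bot%O != 0.
Proof.
move=> bt; have [|f [fE f0 fT]] := @turning_desc_gf 0.
  by rewrite -(proj1 rkP) rk_lt_top.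
have szE : size (labels_above lam \bot%O) = num_labels_rk lam rk 0.
  by rewrite -(num_labels_rkE \bot%O uni) (proj1 rkP).
rewrite /desc_gf_from.
under eq_bigr => t st do rewrite (fE _ _ st (proj1 rkP)).
rewrite (sum_covers_Ind _ (fun i => f i.-1)) szE.
(* the sum over all edges is the window that starts at 0 *)
have := @lift_sum_neq0 _ z _ (fun j => f j *+ width lam \bot%O j.+1) 0 Imz
  _ _ (turning_width _ fT).
rewrite /lift_sum; under eq_bigr => j _ do rewrite mul1r.
apply; first by rewrite -szE size_labels_gt0.
by move=> j jl; apply: width_neq0; rewrite ?szE ?f0.
Qed.

End Uniform.
End Graded.

(** * Real-rootedness *)

Theorem theorem1p5 (disp : Order.disp_t) (P : finTBPOrderType disp)
    (rk : P -> nat) (R : realType) (z : complex R) :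
  rank_function rk ->
  UMEL_shellable rk ->
  root (map_poly intr (h_poly (order_complex P)) : {poly complex R}) z ->
  complex.Im z = 0 /\ complex.Re z <= 0.
Proof.
move=> rkP [dL [L [lam [EL uni mono]]]].
rewrite rootE (horner_h_poly_order_complex rkP EL).
have [bt|bt] := eqVneq (\bot%O : P) \top%O.
  by rewrite bt chain_gf_top oner_eq0.
rewrite (chain_gfE rkP EL) // => h0.
have Imz : complex.Im z = 0.
  by apply: contraTeq h0 => Imz; apply: desc_gf_from_neq0 uni mono _ _ _ _.
split=> //; rewrite leNgt; apply: contraTN h0 => Rez.
by rewrite gt_eqF // (desc_gf_from_gt0 rkP EL) // ltcE Imz eqxx.
Qed.
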